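(* A semigroup $S$ is finite if and only if it is both chain-finite and antichain-finite.
   Context: A semigroup is a set endowed with an associative binary operation, written $\langle x,y\rangle\mapsto xy$ (no commutativity is assumed). A subset $A$ of a semigroup $S$ is a chain if $xy\in\{x,y\}$ for any elements $x,y\in A$ (including $x=y$, so each element of a chain is an idempotent). A subset $A$ of $S$ is an antichain if $xy\notin\{x,y\}$ for any distinct elements $x,y\in A$. A semigroup $S$ is chain-finite if it contains no infinite chain, and antichain-finite if it contains no infinite antichain. *)

(* Defs.v *)
From mathcomp Require Import all_boot.
From mathcomp Require Import all_classical.
Set Implicit Arguments.
Unset Strict Implicit.
Unset Printing Implicit Defensive.

Local Open Scope classical_set_scope.
Local Open Scope group_scope.

(* [semigroupType] imposes no commutativity and allows an empty carrier; the
   choice structure it carries is classically available on every type. *)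

(* The case x = y is included, so the elements of a chain are idempotent. *)
Definition chain (S : semigroupType) (A : set S) : Prop :=
  forall x y : S, A x -> A y -> [set x; y] (x * y).

Definition antichain (S : semigroupType) (A : set S) : Prop :=
  forall x y : S, A x -> A y -> x <> y -> ~ [set x; y] (x * y).

Definition chain_finite (S : semigroupType) : Prop :=
  ~ exists A : set S, infinite_set A /\ chain A.

Definition antichain_finite (S : semigroupType) : Prop :=
  ~ exists A : set S, infinite_set A /\ antichain A.

(* Main.v *)
Require Import Defs.
From HB Require Import structures.
From mathcomp Require Import all_boot.
From mathcomp Require Import all_classical.
From mathcomp Require Import zify.

(** Only the direction from right to left has content, and it rests on two
finiteness facts.

Each idempotent has finitely many roots.  The powers of an element of infinite order form an
antichain, so in an antichain-finite semigroup every element has an idempotent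
power ([exists_idempotent_power]), and S is the union of the sets [roots e] of
elements having e as a power, e idempotent.  The roots x of e
with e * x <> x form an antichain; the others lie in the maximal subgroup at e,
and those of them other than e form an antichain too, whence [finite_roots].

There are finitely many idempotents ([finite_idempotents]).  Otherwise Ramsey's
theorem gives a sequence x_0, x_1, ... of distinct idempotents for which the
truth of each of the equalities x_i * x_j = x_i, x_i * x_j = x_j,
x_j * x_i = x_i, x_j * x_i = x_j is the same for all i < j.  If all four fail,
the sequence is an infinite antichain.  If one of them holds, the principal
left or right ideals of the x_i are monotone.  The x_i need not form a chain,
but certain products of them do, and the finiteness of these auxiliary chains
leads to a contradiction with chain-finiteness: [no_left_ascending] treats
x_i * x_j = x_i, [no_right_descending] treats x_i * x_j = x_j, and the two
remaining equalities are these two in the opposite semigroup. *)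

Set Implicit Arguments.
Unset Strict Implicit.
Unset Printing Implicit Defensive.

Local Open Scope classical_set_scope.
Local Open Scope group_scope.

(** * Ramsey's theorem *)

Lemma infinite_range (T : Type) (f : nat -> T) :
  injective f -> infinite_set (range f).
Proof.
move=> injf fin; apply: infinite_nat.
have <- : f @^-1` range f = [set: nat] by apply/seteqP; split=> // n _; exists n.
by apply: finite_preimage => // m n _ _ /injf.
Qed.

Lemma infinite_injection (T : Type) (A : set T) :
  infinite_set A -> exists2 f : nat -> T, injective f & forall n, A (f n).
Proof.
move=> /infiniteP/card_leP[F].
exists (fun n => val (F (SigSub (mem_set (I : [set: nat] n))))).
  move=> m n /val_inj /(inj (f := F)) e.
  by have /(congr1 val) := e (mem_set I) (mem_set I).
by move=> n; apply/set_mem/valP.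
Qed.

Lemma infinite_fiber (T C : Type) (B : set T) (c : T -> C) :
  infinite_set B -> finite_set (range c) ->
  exists z, infinite_set [set x | B x /\ c x = z].
Proof.
move=> infB finc; apply: contrapT => noz; apply: infB.
have -> : B = \bigcup_(z in range c) [set x | B x /\ c x = z].
  apply/seteqP; split=> [x Bx|x [z _ []] //].
  by exists (c x); [exists x | split].
apply: bigcup_finite => // z _; apply: contrapT => infz.
by apply: noz; exists z.
Qed.

(** The common core of Ramsey's theorem and of [constant_subsequence].  The
colour of a pair is made to depend on its smaller index only; the colours may
range over an infinite type, provided that each index sees finitely many, which
is how the lemma is applied in [no_left_ascending]. *)
Lemma end_homogeneous (C : Type) (c : nat -> nat -> C) :
  (forall i, finite_set (range (c i))) ->
  exists (g : nat -> nat) (z : nat -> C),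
    {homo g : i j / (i < j)%N} /\ forall i j, (i < j)%N -> c (g i) (g j) = z i.
Proof.
move=> finc.
have /choice[step stepP] (B : set nat) : exists p : nat * C * set nat,
    infinite_set B -> [/\ B p.1.1, infinite_set p.2 &
      forall j, p.2 j -> [/\ B j, (p.1.1 < j)%N & c p.1.1 j = p.1.2]].
  have [finB|infB] := pselect (finite_set B); last first.
    have [i Bi] := infinite_setN0 infB.
    have infB' : infinite_set (B `\` `I_i.+1) by apply: infinite_setD.
    have [z infz] := infinite_fiber infB' (finc i).
    exists (i, z, [set j | (B `\` `I_i.+1) j /\ c i j = z]) => _; split=> //=.
    by move=> j [[Bj /negP]]; rewrite -leqNgt.
  by exists (0, c 0 0, set0).
(* B is a decreasing sequence of infinite sets: an index i is picked in B n, and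
   B n.+1 keeps the j > i of B n for which c i j has one chosen value. *)
pose B n := iter n (fun B => (step B).2) [set: nat].
have infB n : infinite_set (B n).
  elim: n => [|n IHn]; first exact: infinite_nat.
  by have [] := stepP _ IHn.
have subB m n : (m <= n)%N -> B n `<=` B m.
  move=> lemn; rewrite -(subnKC lemn).
  elim: (n - m)%N => [|k IHk]; first by rewrite addn0.
  rewrite addnS => j Bj; apply: IHk.
  by have [_ _ /(_ _ Bj)[]] := stepP _ (infB (m + k)%N).
have tailP i j : (i < j)%N -> (step (B i)).2 (step (B j)).1.1.
  move=> ltij; have [Bj _ _] := stepP _ (infB j).
  exact: (subB i.+1 j).
exists (fun n => (step (B n)).1.1), (fun n => (step (B n)).1.2); split=> i j ltij.
  by have [_ _ /(_ _ (tailP _ _ ltij))[]] := stepP _ (infB i).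
by have [_ _ /(_ _ (tailP _ _ ltij))[]] := stepP _ (infB i).
Qed.

(** A colouring that ignores the smaller index of a pair but is
end-homogeneous is constant, except possibly at the first index, which is why
the subsequence is shifted by one. *)
Lemma constant_subsequence (C : Type) (z : nat -> C) :
  finite_set (range z) ->
  exists (g : nat -> nat) (w : C),
    {homo g : i j / (i < j)%N} /\ forall n, z (g n) = w.
Proof.
move=> finz; have [g [k [gE kE]]] := @end_homogeneous _ (fun=> z) (fun=> finz).
exists (g \o succn), (k 0); split=> [i j ltij|n] /=; last exact: kE.
exact: gE.
Qed.

Lemma ramsey (C : finType) (c : nat -> nat -> C) :
  exists (g : nat -> nat) (w : C),
    {homo g : i j / (i < j)%N} /\ forall i j, (i < j)%N -> c (g i) (g j) = w.
Proof.
have [g [z [gE zE]]] := end_homogeneous (fun i => @finite_finset C (range (c i))).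
have [h [w [hE wE]]] := constant_subsequence (@finite_finset C (range z)).
exists (g \o h), w; split=> i j ltij /=; first by apply/gE/hE.
by rewrite zE ?wE//; apply: hE.
Qed.

Lemma increasing_inj (g : nat -> nat) :
  {homo g : i j / (i < j)%N} -> injective g.
Proof. by move=> gE i j eqg; case: (ltngtP i j) => // /gE; rewrite eqg ltnn. Qed.

(** * Idempotent powers and roots of idempotents *)

Section Periodicity.
Variable S : semigroupType.
Implicit Types (x y e : S) (m n : nat).

(** The power of exponent n + 1: a semigroup has no zeroth power. *)
Definition spow x n : S := iter n (mul x) x.

Lemma spowD x m n : spow x m * spow x n = spow x (m + n).+1.
Proof. by elim: m => [|m IHm] //=; rewrite -mulgA IHm. Qed.

Lemma spowSr x n : spow x n.+1 = spow x n * x.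
Proof. by rewrite -[X in _ * X]/(spow x 0) spowD addn0. Qed.

Lemma spow_fixl x y n : x * y = y -> spow x n * y = y.
Proof. by move=> xy; elim: n => //= n IHn; rewrite -mulgA IHn. Qed.

Lemma spow_fixr x y n : x * y = x -> x * spow y n = x.
Proof. by move=> xy; elim: n => //= n IHn; rewrite mulgA xy IHn. Qed.

Hypothesis finS : antichain_finite S.

Lemma finite_of_antichain (A : set S) : antichain A -> finite_set A.
Proof. by move=> antiA; apply: contrapT => infA; apply: finS; exists A. Qed.

(** If x has index at most i + 1 and its period divides p + 1, then the power
of x whose exponent is (i + 1) * (p + 1) is idempotent, since this exponent is
both past the index and a multiple of the period. *)
Lemma exists_idempotent_power x : exists n, spow x n * spow x n = spow x n.
Proof.
have [i [p eqip]] : exists i p, spow x i = spow x (i + p.+1)%N.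
  apply: contrapT => norep.
  have injx : injective (spow x).
    move=> i j eqij; case: (ltngtP i j) => // lt; case: norep.
      exists i, (j - i.+1)%N; rewrite eqij; congr spow; lia.
    exists j, (i - j.+1)%N; rewrite -eqij; congr spow; lia.
  apply: (infinite_range injx); apply: finite_of_antichain.
  by move=> _ _ [m _ <-] [n _ <-] _ [] /=; rewrite spowD => /injx; lia.
(* By the shift in [spow], the exponent (i + 1) * (p + 1) has to be written as
   the successor of i + i * p + p. *)
have periodic t k : spow x (i + k)%N = spow x (i + k + t * p.+1)%N.
  elim: t k => [|t IHt] k; first by rewrite addn0.
  have shift l : spow x (i + l)%N = spow x (i + l + p.+1)%N.
    case: l => [|l]; first by rewrite !addn0.
    by rewrite addnS -spowD eqip spowD; congr spow; lia.
  by rewrite IHt -addnA shift; congr spow; lia.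
exists (i + i * p + p)%N; rewrite spowD -[in RHS]addnA (periodic i.+1).
congr spow; lia.
Qed.

Definition roots e : set S := [set x | exists n, spow x n = e].

(** Let x and y be roots of e.  Iterating x * y = x gives x * e = x, and
iterating x * y = y gives e * y = y, so either equality puts x or y in the
maximal subgroup at e; hence N below is an antichain.  Within this subgroup
cancellation turns x * y = x into y = e, so G below is an antichain too. *)
Lemma finite_roots e : e * e = e -> finite_set (roots e).
Proof.
move=> ee.
have comm x : roots e x -> e * x = x * e.
  by move=> [n <-]; rewrite -spowSr.
pose N := [set x | roots e x /\ e * x <> x].
pose G := [set x | [/\ roots e x, e * x = x & x <> e]].
apply: (@sub_finite_set _ _ (N `|` G `|` [set e])).
  move=> x rx; have [->|xe] := pselect (x = e); first by right.
  by left; have [ex|ex] := pselect (e * x = x); [right | left].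
rewrite !finite_setU; split; last exact: finite_set1.
split; apply: finite_of_antichain.
  move=> x y [rx nx] [ry ny] _ [] /= xy.
    by case: ry => n yn; apply: nx; rewrite comm// -yn spow_fixr.
  by case: rx => n xn; apply: ny; rewrite -xn spow_fixl.
move=> x y [rx ex nx] [ry ey ny] _ [] /= xy.
  case: rx => n xn; apply: ny; rewrite -ey -xn.
  by case: n {xn} => [|n] //; rewrite spowSr -mulgA xy.
case: ry => n yn; apply: nx; rewrite -ex comm//.
by rewrite -yn; case: n {yn} => [|n] //=; rewrite mulgA xy.
Qed.

End Periodicity.

(** * Monotone sequences of idempotents *)

Section IdempotentSequences.
Variable S : semigroupType.
Hypothesis finS : chain_finite S.

Lemma finite_of_chain (A : set S) : chain A -> finite_set A.
Proof. by move=> chA; apply: contrapT => infA; apply: finS; exists A. Qed.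

Variable x : nat -> S.
Hypotheses (injx : injective x) (idx : forall i, x i * x i = x i).

(** For fixed i the elements x_j * x_i with j >= i satisfy u * v = u, so they
form a chain and take finitely many values.  On a subsequence y, the product
y_j * y_i is thus an element z_i independent of j > i.  The z_i form a chain in
turn, so z takes one value w infinitely often; but if z_i = z_j = w with i < j,
then y_j = y_j * z_j = y_j * z_i = z_i = w, and two such j contradict
injectivity. *)
Lemma no_left_ascending :
  ~ (forall i j, (i < j)%N -> x i * x j = x i).
Proof.
move=> ltx.
have lex i j : (i <= j)%N -> x i * x j = x i.
  by rewrite leq_eqVlt => /predU1P[->|/ltx].
(* Taking the maximum makes the colour defined on all pairs, while it stays in
   the chain of the x_j * x_i with j >= i. *)
have [i|g [z [gE zE]]] := @end_homogeneous _ (fun i j => x (maxn i j) * x i).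
  apply: finite_of_chain => _ _ [j _ <-] [k _ <-]; left => /=.
  by rewrite mulgA -[x _ * _ * x (maxn i k)]mulgA (lex i) ?leq_maxl// -mulgA idx.
pose y := x \o g.
have injy : injective y by move=> i j /injx/(increasing_inj gE).
have idy i : y i * y i = y i by apply: idx.
have lty i j : (i < j)%N -> y i * y j = y i by move=> /gE/ltx.
have yz i j : (i < j)%N -> y j * y i = z i.
  by move=> ltij; rewrite -(zE _ _ ltij) (maxn_idPr (ltnW (gE _ _ ltij))).
have yzl i j : (i <= j)%N -> y i * z j = y i.
  move=> leij; rewrite -(yz j j.+1)// mulgA lty//.
  by move: leij; rewrite leq_eqVlt => /predU1P[->|/lty].
have yzr i j : (i < j)%N -> y j * z i = z i.
  by move=> ltij; rewrite -(yz i j)// mulgA idy.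
have finz : finite_set (range z).
  apply: finite_of_chain => _ _ [i _ <-] [j _ <-].
  case: (leqP i j) => [leij|ltji].
    by left => /=; rewrite -{1}(yz i j.+1)// -mulgA yzl ?yz.
  by right => /=; rewrite -{1}(yz i i.+1)// -mulgA !yzr// ltnW.
have [h [w [hE wE]]] := constant_subsequence finz.
have yw n : y (h n.+1) = w.
  by rewrite -(yzl _ _ (leqnn _)) wE -(wE 0) yzr//; apply: hE.
by have /injy/(increasing_inj hE) := etrans (yw 0) (esym (yw 1%N)).
Qed.

(** The products y_n = x_n * ... * x_1 * x_0 decrease in the natural order of
idempotents, and y_n generates the same right ideal as x_n ([xy] and [yx]).
They form a chain, so y takes one value infinitely often; at the indices where
it does, the x_n all generate the same right ideal, so that x_m * x_n = x_n for
all of them and they form an infinite chain. *)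
Lemma no_right_descending :
  ~ (forall i j, (i < j)%N -> x i * x j = x j).
Proof.
move=> ltx.
have lex i j : (i <= j)%N -> x i * x j = x j.
  by rewrite leq_eqVlt => /predU1P[->|/ltx].
pose y := nat_rect (fun=> S) (x 0) (fun n yn => x n.+1 * yn).
have xy n : x n * y n = y n by case: n => [|n] /=; rewrite ?mulgA ?idx.
have yx m n : (m <= n)%N -> y m * x n = x n.
  elim: m => [|m IHm] ltmn /=; first exact: lex.
  by rewrite -mulgA IHm ?lex// ltnW.
have yl m n : (m <= n)%N -> y m * y n = y n.
  by move=> lemn; rewrite -{1}(xy n) mulgA yx.
have yr m n : (m <= n)%N -> y n * y m = y n.
  move=> lemn; rewrite -(subnK lemn); elim: (n - m)%N => [|k IHk].
    exact: yl.
  by rewrite addSn /= -mulgA IHk.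
have finy : finite_set (range y).
  apply: finite_of_chain => _ _ [i _ <-] [j _ <-].
  by case: (leqP i j) => [/yl|/ltnW/yr]; [right | left].
have [g [w [gE wE]]] := constant_subsequence finy.
apply: (@infinite_range _ (x \o g)).
  by move=> i j /injx/(increasing_inj gE).
apply: finite_of_chain => _ _ [i _ <-] [j _ <-]; right => /=.
rewrite -{1}(yx _ _ (leqnn (g j))) wE -(wE i) mulgA xy wE -(wE j).
exact: yx.
Qed.

End IdempotentSequences.

(** * The opposite semigroup *)

(** An alias of the carrier, on which the reversed product can be declared
without clashing with the given one. *)
Definition opposite (S : Type) : Type := S.

Section Opposite.
Variable S : semigroupType.

HB.instance Definition _ := Choice.on (opposite S).

Lemma opposite_mulA : associative (fun x y : opposite S => (y * x : S)).
Proof. by move=> x y z; rewrite mulgA. Qed.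

HB.instance Definition _ := isSemigroup.Build (opposite S) opposite_mulA.

Lemma chain_finite_opposite : chain_finite S -> chain_finite (opposite S).
Proof.
move=> finS [A [infA chA]]; apply: finS; exists A; split=> // x y Ax Ay.
by case: (chA y x Ay Ax) => /= xy; [right | left].
Qed.

End Opposite.

(** * The finiteness criterion *)

Lemma finite_idempotents (S : semigroupType) :
  chain_finite S -> antichain_finite S -> finite_set [set e : S | e * e = e].
Proof.
move=> chS antiS; apply: contrapT => /infinite_injection[x injx idx].
have opS := chain_finite_opposite chS.
pose c i j := (x i * x j == x i, x i * x j == x j,
               x j * x i == x i, x j * x i == x j).
have [g [[[[a b] a'] b'] [gE cE]]] := ramsey c.
pose y := x \o g.
have injy : injective y by move=> i j /injx/(increasing_inj gE).
have idy i : y i * y i = y i by apply: idx.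
have yE i j : (i < j)%N ->
    [/\ (y i * y j == y i) = a, (y i * y j == y j) = b,
        (y j * y i == y i) = a' & (y j * y i == y j) = b'].
  by move=> /cE[].
case: a => [|] in cE yE.
  by apply: (no_left_ascending chS injy idy) => i j /yE[/eqP].
case: b => [|] in cE yE.
  by apply: (no_right_descending chS injy idy) => i j /yE[_ /eqP].
case: a' => [|] in cE yE.
  by apply: (@no_left_ascending (opposite S) opS y) => // i j /yE[_ _ /eqP].
case: b' => [|] in cE yE.
  by apply: (@no_right_descending (opposite S) opS y) => // i j /yE[_ _ _ /eqP].
apply: antiS; exists (range y); split; first exact: infinite_range.
move=> _ _ [i _ <-] [j _ <-] nij.
case: (ltngtP i j) => [/yE|/yE|eqij]; last by rewrite eqij in nij.
  by move=> [/eqP n1 /eqP n2 _ _] [].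
by move=> [_ _ /eqP n1 /eqP n2] [].
Qed.

Theorem theorem1 (S : semigroupType) :
  finite_set [set: S]%classic <-> chain_finite S /\ antichain_finite S.
Proof.
split=> [finS|[chS antiS]].
  by split=> -[A [infA _]]; apply: infA; apply: sub_finite_set finS.
have -> : [set: S] = \bigcup_(e in [set e : S | e * e = e]) roots e.
  apply/seteqP; split=> // x _.
  have [n idn] := exists_idempotent_power antiS x.
  by exists (spow x n) => //; exists n.
apply: bigcup_finite => [|e ee]; first exact: finite_idempotents.
exact: finite_roots.
Qed.
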